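(* Suppose $m_1\le m_2$. For every motion of the dumbbell (in which the two masses never hit the floor simultaneously), the total number of collisions of the dumbbell with the floor is bounded above by $$N_\gamma=\left\lceil \frac{\pi}{\gamma}\right\rceil+1,\qquad \gamma=\pi-2\arctan\sqrt{\beta_2/\beta_1}.$$
   Context: A dumbbell consists of two point masses $m_1,m_2>0$ joined by a weightless rigid rod of length $1$, moving in the plane above the floor $\{y=0\}$ with no external forces. Let $\beta_1=\frac{m_1}{m_1+m_2}$, $\beta_2=\frac{m_2}{m_1+m_2}=1-\beta_1$, $m=m_1+m_2$. Let $y$ be the height of the center of mass and $\phi$ the angle (mod $2\pi$, counterclockwise from the horizontal) of the rod, so that the heights of the masses are $y_1=y+\beta_2\sin\phi\ge 0$ and $y_2=y-\beta_1\sin\phi\ge 0$. The horizontal velocity of the center of mass is constant and is taken to be $0$. Between collisions $\dot y$ and $\dot\phi$ are constant. The kinetic energy is $\frac12 m\dot y^2+\frac12\beta_1\beta_2 m\dot\phi^2$. A collision occurs when $y_1=0$ or $y_2=0$. Collisions are elastic: with $Y=y/\sqrt{\beta_1\beta_2}$, the point $(Y,\phi)$ moves as a billiard particle, i.e. with constant velocity in straight lines and specular reflection (in the Euclidean metric of the $(\phi,Y)$-plane, $\phi$ taken mod $2\pi$), in the region $Y\ge\max\{-\sqrt{\beta_2/\beta_1}\sin\phi,\ \sqrt{\beta_1/\beta_2}\sin\phi\}$. Collisions of the dumbbell with the floor are exactly the bounces of this particle off the boundary of the region. Trajectories hitting the corners $\phi=0,\pi$ of the boundary (both masses hitting the floor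 simultaneously) are excluded. *)

(* Defs.v *)
From HB Require Import structures.
From mathcomp Require Import all_boot all_order all_algebra.
From mathcomp Require Import all_classical all_reals all_analysis.
Set Implicit Arguments.
Unset Strict Implicit.
Unset Printing Implicit Defensive.
Import Order.TTheory GRing.Theory Num.Theory.
Import numFieldNormedType.Exports.
Local Open Scope classical_set_scope.
Local Open Scope ring_scope.

Section Dumbbell.
Context {R : realType}.
Variables m1 m2 : R.

Definition beta1 : R := m1 / (m1 + m2).
Definition beta2 : R := m2 / (m1 + m2).

(* A motion is given by the height [y] of the center of mass and a real-valued
   (continuous) lift [phi] of the angle of the rod, which is only defined
   modulo 2 pi. *)
Variables y phi : R -> R.

Definition height1 (t : R) : R := y t + beta2 * sin (phi t).
Definition height2 (t : R) : R := y t - beta1 * sin (phi t).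

Definition scaledY (t : R) : R := y t / Num.sqrt (beta1 * beta2).

(* Velocities are pairs (phi', Y') in the Euclidean (phi, Y)-plane. *)
Definition moves_with (v : R * R) (t s : R) : Prop :=
  phi s = phi t + (s - t) * v.1 /\ scaledY s = scaledY t + (s - t) * v.2.

Definition incoming (t : R) (v : R * R) : Prop :=
  \forall s \near t^'-, moves_with v t s.

Definition outgoing (t : R) (v : R * R) : Prop :=
  \forall s \near t^'+, moves_with v t s.

(* height1 = 0 is the curve Y = slope1 * sin phi, and height2 = 0 is the curve
   Y = slope2 * sin phi. *)
Definition slope1 : R := - Num.sqrt (beta2 / beta1).
Definition slope2 : R := Num.sqrt (beta1 / beta2).

Definition dot (v w : R * R) : R := v.1 * w.1 + v.2 * w.2.

Definition normal (k a : R) : R * R := (- (k * cos a), 1).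

(* Specular reflection in the tangent line of Y = k * sin phi at phi = a. *)
Definition reflect (k a : R) (v : R * R) : R * R :=
  let n := normal k a in
  let c := 2 * dot v n / dot n n in
  (v.1 - c * n.1, v.2 - c * n.2).

(* [T] is the time interval on which the motion is considered. Nothing is
   prescribed when both masses touch the floor simultaneously. *)
Record dumbbell_motion (T : set R) : Prop := DumbbellMotion {
  above_floor : forall t, T t -> 0 <= height1 t /\ 0 <= height2 t;
  free_flight : forall t, T t -> 0 < height1 t -> 0 < height2 t ->
    exists v, incoming t v /\ outgoing t v;
  bounce1 : forall t, T t -> height1 t = 0 -> 0 < height2 t ->
    exists v, incoming t v /\ outgoing t (reflect slope1 (phi t) v);
  bounce2 : forall t, T t -> 0 < height1 t -> height2 t = 0 ->
    exists v, incoming t v /\ outgoing t (reflect slope2 (phi t) v) }.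

(* The velocity jump discards contacts that are not bounces: a mass grazing the
   floor tangentially (for y = beta2 constant and phi' constant nonzero, the
   first mass does so at every turn, forever), or lying at rest on it. *)
Definition collisions (T : set R) : set R :=
  [set t | [/\ T t, height1 t = 0 \/ height2 t = 0 &
    exists v w, [/\ incoming t v, outgoing t w & v <> w]]].

Definition wedge_angle : R := pi - 2 * atan (Num.sqrt (beta2 / beta1)).

Definition Ngamma : int := Num.ceil (pi / wedge_angle) + 1.

End Dumbbell.

(* Main.v *)
Require Import Defs.
From HB Require Import structures.
From mathcomp Require Import all_boot all_order all_algebra finmap.
From mathcomp Require Import all_classical all_reals all_analysis.
From mathcomp Require Import ring lra zify.
Import Order.TTheory GRing.Theory Num.Theory.
Import numFieldNormedType.Exports.
Local Open Scope classical_set_scope.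
Local Open Scope ring_scope.

(** The point (phi, Y) is a billiard particle above a periodic row of concave
    arches: tall ones, arches of [- K * sin] with [K = sqrt (beta2 / beta1)],
    and low ones, arches of [K^-1 * sin], in alternation; [K >= 1] since
    m1 <= m2.  Write (u, w) for a velocity, A for [atan K], so that the wedge
    angle is gamma = pi - 2 A, and call [atan (w / |u|)] the elevation of the
    flight; it is the direction of motion with left and right identified.

    The proof follows the elevation from flight to flight.
    - A bounce only adds upward velocity and keeps the speed, so the elevation
      never decreases ([elevation_mirror]).
    - A boundary of slope at most [tan s] in absolute value forces the elevation
      below s before the bounce and above - s after it ([elevation_lt],
      [elevation_gt]).  Here s is A on a tall arch and pi/2 - A = gamma/2 on a
      low one.
    - A bounce off a tall arch that has both a predecessor and a successor
      reverses the horizontal velocity ([tall_bump_reverses]).  The reason is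
      concavity: a flight that leaves an arch above its tangent on the ascending
      side passes over the top of a tall arch and never meets the boundary again
      ([bump_below_tangent]); the same holds for the incoming flight with time
      reversed.  A reversing bounce turns the elevation by
      pi - 2 atan |slope|, which is at least gamma ([elevation_reversal]).
    - Two bounces off low arches are never consecutive
      ([no_consecutive_low]): by concavity the flight between them would have
      to descend past a trough of the sine, that is through the top of a tall
      arch.

    Counting is then immediate ([bounce_count]).  Between two low bounces there
    is a tall one with a gain of gamma, but the elevation has to stay between
    - gamma/2 after the first and gamma/2 before the second, so there is at most
    one low bounce.  For n tall bounces, the elevation starts above - A and ends
    below A, and n - 2 of them gain gamma each, so
    (n - 2) gamma < 2 A = pi - gamma and n <= ceil (pi / gamma).

    It remains to see that a motion is a chain of straight flights: between
    consecutive collisions the velocity is constant ([flight]) and collisions do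
    not accumulate ([finite_collisions]).  Both hold locally by the form of the
    laws of motion and spread along an interval by induction on the reals
    ([real_induction]). *)

(** * Concavity of a sine arch *)

Section Trig.
Context {R : realType}.
Implicit Types a b x k s K : R.

Lemma cos_itv x : -1 <= cos x <= 1.
Proof. by rewrite cos_geN1 cos_le1. Qed.

(** Replacing an angle in the upper half circle by its representative in
    [0, pi] spares all bookkeeping of multiples of 2 pi. *)
Lemma angle_reduction a : 0 <= sin a ->
  exists z, [/\ 0 <= z <= pi, sin z = sin a & cos z = cos a].
Proof.
move=> sa; exists (acos (cos a)).
have h := cos_itv a.
split; first by rewrite acos_ge0// acos_lepi.
  by rewrite sin_acos// -sin2cos2 sqrtr_sqr ger0_norm.
by rewrite acosK// in_itv.
Qed.

Lemma cos_le0_itv x : pi / 2 <= x <= pi / 2 + pi -> cos x <= 0.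
Proof.
move=> /andP[h1 h2]; rewrite -oppr_ge0 -sinBpihalf.
by apply: sin_ge0_pi; apply/andP; split; lra.
Qed.

(** On the ascending side of an arch the tangent stays above the arch up to its
    top, by the mean value theorem and the decrease of cosine; from there on it
    is above the height 1 of the top, hence above every arch. *)
Lemma sin_below_tangent a x : 0 < sin a -> 0 <= cos a -> a <= x ->
  1 <= sin a + (x - a) * cos a \/
  0 <= sin x <= sin a + (x - a) * cos a.
Proof.
move=> sa ca ax; have pi0 := pi_gt0 R.
have [z [/andP[z0 zpi] sz cz]] := angle_reduction a (ltW sa).
have -> : sin x = sin (z + (x - a)).
  by rewrite -[in LHS](subrKC a x) sinD -sz -cz -sinD.
have zpi2 : z <= pi / 2.
  rewrite leNgt; apply/negP => zpi2.
  suff : cos z < 0 by rewrite cz; lra.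
  rewrite -oppr_gt0 -sinBpihalf; apply: sin_gt0_pi; lra.
have chord w : z <= w -> w <= pi / 2 -> sin w <= sin a + (w - z) * cos a.
  rewrite le_eqVlt => /predU1P[<- _|zw wpi]; first by rewrite subrr mul0r addr0 sz.
  have [c] := @MVT R sin cos z w zw (fun y _ => is_derive_sin y)
    (continuous_subspaceT (@continuous_sin R)).
  rewrite in_itv/= => /andP[zc cw] e.
  have cc : cos c <= cos a.
    by rewrite -cz ltW// ltr_cos ?in_itv/=; lra.
  have : cos c * (w - z) <= (w - z) * cos a by rewrite mulrC ler_wpM2l//; lra.
  rewrite -sz; lra.
case: (leP (z + (x - a)) (pi / 2)) => hX; [right|left].
  apply/andP; split; first by apply: sin_ge0_pi; lra.
  apply: le_trans (chord _ _ hX) _; first by lra.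
  by rewrite addrAC subrr add0r.
have := chord (pi / 2) zpi2 (lexx _); rewrite sin_pihalf => /le_trans; apply.
by rewrite lerD2l ler_wpM2r//; lra.
Qed.

Lemma sin_trough_between a b : 0 < sin a -> cos a <= 0 -> 0 < cos b -> a < b ->
  exists2 x, a < x < b & sin x = -1.
Proof.
move=> sa ca cb ab; have pi0 := pi_gt0 R.
have [z [/andP[z0 zpi] sz cz]] := angle_reduction a (ltW sa).
have zpi2 : pi / 2 <= z.
  rewrite leNgt; apply/negP => zpi2.
  suff : 0 < cos z by lra.
  by apply: cos_gt0_pihalf; lra.
(* As z represents a, this angle is congruent to 3 pi / 2. *)
exists (a + (pi + pi / 2 - z)); last first.
  rewrite sinD -sz -cz -sinD subrKC [LHS]sinD sinpi cospi sin_pihalf.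
  by rewrite mul0r add0r mulN1r.
apply/andP; split; first lra.
rewrite ltNge; apply/negP => bx.
suff : cos b <= 0 by lra.
rewrite -(subrKC a b) cosD -sz -cz -cosD.
by apply: cos_le0_itv; lra.
Qed.

(** A point strictly above the tangent on the ascending side has either passed
    over the top of the arch or lies strictly above the arch itself.  The cases
    x < a and k < 0 reduce to [sin_below_tangent] by the symmetries
    x -> pi - x and x -> x + pi. *)
Lemma bump_below_tangent k a x Y :
  0 < k * sin a -> 0 <= (x - a) * (k * cos a) ->
  k * sin a + (x - a) * (k * cos a) < Y ->
  `|k| < Y \/ 0 <= k * sin x < Y.
Proof.
wlog k0 : k a x / 0 < k => [hw|].
  move=> h1 h2 h3; have k0 : k != 0 by apply: contraTneq h1 => ->; rewrite mul0r ltxx.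
  case: (ltgtP k 0) => [kn|kp|ke]; [|exact: (hw k a x)|by rewrite ke eqxx in k0].
  have := hw (- k) (a + pi) (x + pi); rewrite oppr_gt0 !sinDpi !cosDpi !mulrNN normrN.
  have -> : x + pi - (a + pi) = x - a by ring.
  by apply.
rewrite pmulr_rgt0// => sa.
wlog ax : a x sa / a <= x => [hw|].
  case: (leP a x) => [|xa]; first exact: hw.
  have := hw (pi - a) (pi - x); rewrite !sinB !cosB !sinpi !cospi !mul0r !mulN1r !sub0r !opprK !addr0.
  have -> : pi - x - (pi - a) = a - x by ring.
  move=> h h1 h2; apply: h => //; [lra| |]; by rewrite mulrN mulrN -mulNr opprB.
rewrite le_eqVlt in ax; case/predU1P : ax => [<- _ |ax].
  by rewrite subrr mul0r addr0 => h; right; rewrite h ltW // mulr_gt0.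
rewrite pmulr_rge0 ?subr_gt0// pmulr_rge0// => ca.
rewrite mulrCA -mulrDr (gtr0_norm k0) => hY.
have [h|/andP[h1 h2]] := sin_below_tangent a x sa ca (ltW ax); [left|right].
  by apply: le_lt_trans hY; rewrite -{1}(mulr1 k) ler_pM2l.
rewrite mulr_ge0 ?(ltW k0)//=.
by apply: le_lt_trans hY; rewrite ler_pM2l.
Qed.

End Trig.

(** * Specular reflection and elevation *)

Section Mirror.
Context {R : realType}.
Implicit Types (s K : R) (v : R * R).

(** Up to a positive factor, the velocity component normal to a boundary of
    slope [s], directed upwards. *)
Definition normal_rate s v : R := v.2 - s * v.1.

(** The upward normal is (-s, 1), and reflection adds a multiple of it. *)
Definition mirror s v : R * R :=
  (v.1 + 2 * normal_rate s v / (1 + s ^+ 2) * s, v.2 - 2 * normal_rate s v / (1 + s ^+ 2)).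

Definition elevation v : R := atan (v.2 / `|v.1|).

Lemma sqr1_gt0 s : 0 < 1 + s ^+ 2.
Proof. by rewrite ltr_wpDr// sqr_ge0. Qed.

Lemma normal_rate_mirror s v : normal_rate s (mirror s v) = - normal_rate s v.
Proof.
have h := lt0r_neq0 (sqr1_gt0 s); rewrite /mirror /normal_rate /=; field; exact: h.
Qed.

Lemma mirror_norm s v :
  (mirror s v).1 ^+ 2 + (mirror s v).2 ^+ 2 = v.1 ^+ 2 + v.2 ^+ 2.
Proof.
have h := lt0r_neq0 (sqr1_gt0 s); rewrite /mirror /normal_rate /=; field; exact: h.
Qed.

Lemma mirror_up s v : normal_rate s v <= 0 -> v.2 <= (mirror s v).2.
Proof.
move=> h /=; rewrite lerBrDr gerDl pmulr_lle0 ?invr_gt0 ?sqr1_gt0//.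
by rewrite pmulr_rle0.
Qed.

(** Compatibility with the left-right symmetry of the plane. *)
Lemma mirror_flip s (v : R * R) : mirror (- s) (- v.1, v.2) = (- (mirror s v).1, (mirror s v).2).
Proof. by rewrite /mirror /normal_rate /= sqrrN !mulrNN mulrN opprD. Qed.

Lemma elevation_lt K s v : v.1 != 0 -> `|s| <= K -> normal_rate s v < 0 ->
  elevation v < atan K.
Proof.
move=> v0 sK; rewrite /normal_rate subr_lt0 => h; apply: lt_atan.
rewrite ltr_pdivrMr ?normr_gt0//; apply: lt_le_trans h _.
by rewrite (le_trans (ler_norm _))// normrM ler_wpM2r.
Qed.

Lemma elevation_gt K s v : v.1 != 0 -> `|s| <= K -> 0 < normal_rate s v ->
  - atan K < elevation v.
Proof.
move=> v0 sK; rewrite /normal_rate subr_gt0 => h; rewrite -atanN; apply: lt_atan.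
rewrite ltr_pdivlMr ?normr_gt0//; apply: le_lt_trans h.
rewrite mulNr lerNl (le_trans (ler_norm _))// normrN normrM ler_wpM2r//.
Qed.

(** At fixed speed the elevation is the arcsine of the normalized upward
    velocity, hence increases with it. *)
Lemma le_elevation v v' : v.1 != 0 -> v'.1 != 0 ->
  v.1 ^+ 2 + v.2 ^+ 2 = v'.1 ^+ 2 + v'.2 ^+ 2 -> v.2 <= v'.2 ->
  elevation v <= elevation v'.
Proof.
case: v v' => [u w] [u' w'] /= u0 u0' e ww; apply: le_atan.
rewrite /= ler_pdivrMr ?normr_gt0// mulrAC ler_pdivlMr ?normr_gt0//.
move: e u0 u0'; rewrite -(real_normK (num_real u)) -(real_normK (num_real u')) -!normr_gt0.
move: `|u| `|u'| => {u u'} p q e p0 q0.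
have sq_le (x y : R) : 0 < x -> 0 < y -> x ^+ 2 <= y ^+ 2 -> x <= y.
  by move=> x0 y0; rewrite ler_pXn2r// nnegrE ltW.
case: (leP 0 w) => w0.
  have : q <= p.
    apply: sq_le => //; have : 0 <= (w' - w) * (w' + w) by rewrite mulr_ge0//; lra.
    rewrite !expr2 in e *; lra.
  by move=> qp; apply: ler_pM; lra.
case: (leP 0 w') => w0'.
  apply: (@le_trans _ _ 0); last by rewrite mulr_ge0// ltW.
  by rewrite mulr_le0_ge0// ltW.
have : p <= q.
  apply: sq_le => //; have : 0 <= (w' - w) * - (w' + w) by rewrite mulr_ge0//; lra.
  rewrite !expr2 in e *; lra.
move=> pq; apply: (@le_trans _ _ (w * p)).
  by rewrite ler_nM2l.
by rewrite ler_pM2r.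
Qed.

Lemma elevation_mirror s v : v.1 != 0 -> (mirror s v).1 != 0 -> normal_rate s v <= 0 ->
  elevation v <= elevation (mirror s v).
Proof.
by move=> h1 h2 h3; apply: le_elevation; rewrite ?mirror_norm// mirror_up.
Qed.

(** For u > 0, write v = r (cos E, sin E) and s = tan t.  The reflected
    direction is 2 t - E; when it points to the left, identifying left and right
    turns it into pi - (2 t - E). *)
Lemma elevation_reversal s v : normal_rate s v < 0 -> v.1 * (mirror s v).1 < 0 ->
  elevation (mirror s v) = elevation v + (pi - 2 * atan `|s|).
Proof.
wlog v0 : s v / 0 < v.1 => [hw|] h1 h2.
  have : v.1 != 0 by apply: contraTneq h2 => ->; rewrite mul0r ltxx.
  case: (ltgtP v.1 0) => // [vn|vp] _; last exact: hw.
  have := hw (- s) (- v.1, v.2); rewrite mirror_flip normrN.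
  rewrite /elevation /= !normrN; apply; rewrite ?oppr_gt0//.
    by rewrite /normal_rate /= mulrNN.
  by rewrite mulrNN.
move: h2; rewrite pmulr_rlt0// => h2.
have pi0 := pi_gt0 R.
(* A boundary descending to the right would push the particle further right. *)
have s0 : 0 < s.
  rewrite ltNge; apply/negP => s0; move: h2; apply/negP; rewrite -leNgt /=.
  rewrite addr_ge0 ?(ltW v0)// -mulrA mulr_le0 ?invr_ge0//.
    by rewrite pmulr_rle0// ltW.
  by rewrite pmulr_rle0// invr_gt0 sqr1_gt0.
rewrite /elevation (gtr0_norm v0) (ltr0_norm h2) (gtr0_norm s0).
set E := atan (v.2 / v.1); set t := atan s.
have cE : 0 < cos E by apply: cos_gt0_pihalf; rewrite atan_gtNpi2 atan_ltpi2.
have ct : 0 < cos t by apply: cos_gt0_pihalf; rewrite atan_gtNpi2 atan_ltpi2.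
pose r := v.1 / cos E.
have r0 : 0 < r by rewrite divr_gt0.
have v1 : v.1 = r * cos E by rewrite /r divfK// gt_eqF.
have v2 : v.2 = r * sin E.
  have : tan E = v.2 / v.1 by rewrite atanK.
  rewrite /r /tan => e.
  have -> : sin E = v.2 / v.1 * cos E by rewrite -e divfK// gt_eqF.
  by field; rewrite !gt_eqF.
have es : s = sin t / cos t by rewrite -[LHS]atanK.
have ect : 1 + s ^+ 2 = (cos t) ^- 2 by rewrite cos2_tan2 ?gt_eqF// atanK.
have sct : sin t ^+ 2 = 1 - cos t ^+ 2 by rewrite sin2cos2.
have m1 : (mirror s v).1 = - (r * cos (E + pi - 2 * t)).
  rewrite addrAC cosDpi mulrN opprK.
  rewrite cosB (_ : 2 * t = t + t) ?cosD ?sinD; last by rewrite mulr_natl mulr2n.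
  rewrite /mirror /normal_rate /= ect v1 v2 es.
  have -> : cos t * cos t - sin t * sin t = 2 * cos t ^+ 2 - 1 by rewrite -[sin t * _]expr2 sct; ring.
  have -> : r * cos E + 2 * (r * sin E - sin t / cos t * (r * cos E)) / cos t ^- 2 * (sin t / cos t)
     = r * (cos E * (1 - 2 * sin t ^+ 2) + 2 * sin E * sin t * cos t) by field; rewrite gt_eqF.
  rewrite sct; ring.
have m2 : (mirror s v).2 = r * sin (E + pi - 2 * t).
  rewrite addrAC sinDpi.
  rewrite sinB (_ : 2 * t = t + t) ?cosD ?sinD; last by rewrite mulr_natl mulr2n.
  rewrite /mirror /normal_rate /= ect v1 v2 es.
  have -> : cos t * cos t - sin t * sin t = 2 * cos t ^+ 2 - 1 by rewrite -[sin t * _]expr2 sct; ring.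
  have -> : r * sin E - 2 * (r * sin E - sin t / cos t * (r * cos E)) / cos t ^- 2
     = r * (sin E - 2 * cos t ^+ 2 * sin E + 2 * sin t * cos t * cos E) by field; rewrite gt_eqF.
  ring.
have cpos : 0 < cos (E + pi - 2 * t).
  by move: h2; rewrite m1 oppr_lt0 pmulr_rgt0.
have Et1 : - (pi / 2) < E by exact: atan_gtNpi2.
have Et2 : E < pi / 2 by exact: atan_ltpi2.
have t2 : t < pi / 2 by exact: atan_ltpi2.
have t1 : 0 < t by rewrite -(@atan0 R); exact: lt_atan.
(* The leftward direction excludes the other branch of the tangent. *)
have lt1 : E + pi - 2 * t < pi / 2.
  rewrite ltNge; apply/negP => h; move: cpos; apply/negP; rewrite -leNgt.
  apply: cos_le0_itv; lra.
rewrite m1 m2 opprK invfM mulrACA divff ?gt_eqF// mul1r.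
have gt1 : - (pi / 2) < E + pi - 2 * t by lra.
rewrite -/(tan _) tanK; last by rewrite in_itv/= gt1.
by rewrite -addrA.
Qed.

End Mirror.

(** * Consecutive bounces *)

Section Contact.
Context {R : realType}.
Implicit Types (k a : R) (p q v : R * R).

(** The two families of arches rise above height 0 over complementary sets of
    angles, so positivity of the height tells on which one the particle is. *)
Definition contact k p := p.2 = k * sin p.1 /\ 0 < p.2.

(** Two boundary points joined by a flight: if [q] is above the tangent at [p],
    then [q] lies on the descending side of [p], for on the ascending side it
    would be above an arch at least as high as its own. *)
Lemma contact_descending k k' p q : contact k p -> contact k' q ->
  `|k'| <= `|k| -> (k' = k \/ k' * k < 0) ->
  p.2 + (q.1 - p.1) * (k * cos p.1) < q.2 ->
  (q.1 - p.1) * (k * cos p.1) < 0.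
Proof.
move=> [-> p0] [qE q0] kk kk' h; rewrite ltNge; apply/negP => asc.
have [|/andP[]] := bump_below_tangent _ _ _ _ p0 asc h.
  apply/negP; rewrite -leNgt qE; apply: le_trans kk.
  rewrite (le_trans (ler_norm _))// normrM ler_piMr//.
  by rewrite ler_norml sin_le1 sin_geN1.
case: kk' qE q0 => [->|kk'] ->; first by rewrite ltxx.
move=> q0 kq _; have : k' * k * sin q.1 ^+ 2 < 0.
  by rewrite pmulr_llt0// exprn_even_gt0//=; apply: contraTneq q0 => ->; rewrite mulr0 ltxx.
apply/negP; rewrite -leNgt expr2 mulrACA mulr_ge0// ltW//.
Qed.

(** Both the previous contact [p] and the next contact [q] are above the tangent
    at [b], hence both on its descending side; so the particle leaves to the
    side from which it came. *)
Lemma tall_bump_reverses k kp kq p b q v (t t' : R) :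
  contact k b -> contact kp p -> contact kq q ->
  `|kp| <= `|k| -> (kp = k \/ kp * k < 0) ->
  `|kq| <= `|k| -> (kq = k \/ kq * k < 0) ->
  0 < t -> p = (b.1 - t * v.1, b.2 - t * v.2) ->
  let v' := mirror (k * cos b.1) v in
  0 < t' -> q = (b.1 + t' * v'.1, b.2 + t' * v'.2) ->
  normal_rate (k * cos b.1) v < 0 -> v.1 * v'.1 < 0.
Proof.
move=> kb kpp kqq kp1 kp2 kq1 kq2 t0 pE v' t'0 qE vs.
set s := k * cos b.1 in vs v' qE *.
have v's : 0 < normal_rate s v' by rewrite normal_rate_mirror oppr_gt0.
clearbody v'.
have : 0 < v.1 * s.
  have := contact_descending _ _ _ _ kb kpp kp1 kp2; rewrite pE /= -/s addrAC subrr sub0r.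
  rewrite mulNr oppr_lt0 -mulrA pmulr_rgt0//; apply.
  rewrite ltrD2l ltrN2 ltr_pM2l//; move: vs; rewrite /normal_rate subr_lt0 mulrC//.
have : v'.1 * s < 0.
  have := contact_descending _ _ _ _ kb kqq kq1 kq2; rewrite qE /= -/s addrAC subrr add0r.
  rewrite -mulrA pmulr_rlt0//; apply.
  rewrite ltrD2l ltr_pM2l//; move: v's; rewrite /normal_rate subr_gt0 mulrC//.
move=> h1 h2; have : (v.1 * v'.1) * s ^+ 2 < 0 by rewrite expr2 mulrACA pmulr_rlt0.
by rewrite pmulr_llt0// exprn_even_gt0//=; apply: contraTneq h2 => ->; rewrite mulr0 ltxx.
Qed.

(** Each of [p], [q] lies on the descending side of the other, so the flight
    crosses an angle with sine -1, where the floor has height K, whereas both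
    ends are at height less than K^-1 <= K. *)
Lemma no_consecutive_low K p q v (t : R) : 1 <= K ->
  contact K^-1 p -> contact K^-1 q -> 0 < t ->
  q = (p.1 + t * v.1, p.2 + t * v.2) ->
  0 < normal_rate (K^-1 * cos p.1) v -> normal_rate (K^-1 * cos q.1) v < 0 ->
  exists2 r, 0 < r < t & p.2 + r * v.2 < - K * sin (p.1 + r * v.1).
Proof.
move=> K1 kp kq t0 qE vp vq; have K0 : 0 < K by lra.
have hp : v.1 * cos p.1 < 0.
  have := contact_descending _ _ _ _ kp kq (lexx _) (or_introl erefl).
  rewrite qE /= [_ + _ - p.1]addrAC subrr add0r -mulrA pmulr_rlt0// [v.1 * (_ * _)]mulrCA pmulr_rlt0 ?invr_gt0//.
  apply; rewrite ltrD2l ltr_pM2l//; move: vp; rewrite /normal_rate subr_gt0.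
  by congr (_ < _); ring.
have hq : 0 < v.1 * cos q.1.
  have := contact_descending _ _ _ _ kq kp (lexx _) (or_introl erefl).
  have -> : p.1 - q.1 = - (t * v.1) by rewrite qE /=; ring.
  rewrite mulNr oppr_lt0 -mulrA pmulr_rgt0// [v.1 * (_ * _)]mulrCA pmulr_rgt0 ?invr_gt0//.
  apply; rewrite -ltrBDl (_ : p.2 - q.2 = - (t * v.2)); last by rewrite qE /=; ring.
  rewrite ltrN2 ltr_pM2l//; move: vq; rewrite /normal_rate subr_lt0.
  by congr (_ < _); ring.
have [x [x0 xt sx]] : exists x, [/\ 0 < x, x < t & sin (p.1 + x * v.1) = -1].
  have sgt r : contact K^-1 r -> 0 < sin r.1.
    by case=> -> ; rewrite pmulr_rgt0// invr_gt0.
  have := sgt _ kp; have := sgt _ kq; move: (hp) (hq).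
  case: (ltgtP v.1 0) => v0; last by rewrite v0 mul0r ltxx.
    rewrite nmulr_rlt0// nmulr_rgt0// => cp cq sq sp.
    have [|x /andP[x1 x2] xs] := sin_trough_between _ _ sq (ltW cq) cp.
      by rewrite qE /= gtrDl pmulr_rlt0.
    exists ((x - p.1) / v.1); rewrite divfK ?lt_eqF// subrKC; split => //.
      by rewrite ltr_ndivlMr// mul0r subr_lt0.
    by rewrite ltr_ndivrMr// ltrBrDl; rewrite qE in x1.
  rewrite pmulr_rlt0// pmulr_rgt0// => cp cq sq sp.
  have [|x /andP[x1 x2] xs] := sin_trough_between _ _ sp (ltW cp) cq.
    by rewrite qE /= ltrDl pmulr_rgt0.
  exists ((x - p.1) / v.1); rewrite divfK ?gt_eqF// subrKC; split => //.
    by rewrite ltr_pdivlMr// mul0r subr_gt0.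
  by rewrite ltr_pdivrMr// ltrBlDl; rewrite qE in x2.
exists x; first by rewrite x0.
rewrite sx mulrNN mulr1.
(* A low arch reaches K^-1 only at its top, where the slope vanishes. *)
have low r : contact K^-1 r -> v.1 * cos r.1 != 0 -> r.2 < K.
  case=> -> _ h; have cr : cos r.1 != 0 by apply: contraNneq h => ->; rewrite mulr0.
  have : sin r.1 < 1.
    have := cos2Dsin2 r.1; have : 0 < cos r.1 ^+ 2 by rewrite exprn_even_gt0.
    by have := sin_le1 r.1; nra.
  have : K^-1 <= 1 by rewrite invf_le1.
  have : 0 < K^-1 by rewrite invr_gt0.
  nra.
have p2 : p.2 < K by apply: low => //; rewrite lt_eqF.
have : q.2 < K by apply: low => //; rewrite gt_eqF.
rewrite qE /= => q2.
have : t * (p.2 + x * v.2) = (t - x) * p.2 + x * (p.2 + t * v.2) by ring.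
move=> e; rewrite -(ltr_pM2l t0) e.
have -> : t * K = (t - x) * K + x * K by ring.
by rewrite ltrD// ltr_pM2l// subr_gt0.
Qed.

End Contact.

(** * Counting bounces by elevation *)

Section Count.
Context {R : realType}.

(** Bounces are numbered from 0 to [m], and [E i] is the elevation on the flight
    from bounce [i] to bounce [i.+1].  Since at most one bounce is low, at least
    [m] of the [m.+1] bounces are tall. *)
Lemma bounce_count (A : R) (m : nat) (tall : pred nat) (E : nat -> R) :
  pi / 4 <= A -> A < pi / 2 ->
  (forall i, (i < m)%N -> - (if tall i then A else pi / 2 - A) < E i) ->
  (forall i, (i < m)%N -> E i < if tall i.+1 then A else pi / 2 - A) ->
  (forall i, (i.+1 < m)%N -> E i <= E i.+1) ->
  (forall i, (i.+1 < m)%N -> tall i.+1 -> E i + (pi - 2 * A) <= E i.+1) ->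
  (forall i, (i < m)%N -> tall i || tall i.+1) ->
  (m%:R - 1) * (pi - 2 * A) < pi.
Proof.
move=> A1 A2 out inn mono gain nosm.
pose nb i := (\sum_(j < i) tall j)%N; pose ns i := (\sum_(j < i) ~~ tall j)%N.
have nbS i : nb i.+1 = (nb i + tall i)%N by rewrite /nb big_ord_recr.
have nsS i : ns i.+1 = (ns i + ~~ tall i)%N by rewrite /ns big_ord_recr.
have nb0 : nb 0%N = 0%N by rewrite /nb big_ord0.
have ns0 : ns 0%N = 0%N by rewrite /ns big_ord0.
have nbs i : (nb i + ns i = i)%N.
  rewrite /nb /ns; elim: i => [|i IH]; first by rewrite !big_ord0.
  by rewrite !big_ord_recr /= addnACA IH; case: (tall i); rewrite ?addn0 addn1.
have pi0 := pi_gt0 R.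
(* Every tall bounce but the first contributes a full gain. *)
have C i : (i < m)%N -> (0 < nb i.+1)%N ->
    - A + ((nb i.+1)%:R - 1) * (pi - 2 * A) < E i.
  elim: i => [|i IH] im.
    rewrite nbS nb0; have := out _ im.
    by case: (tall 0) => //=; rewrite subrr mul0r addr0.
  rewrite nbS; case: (boolP (tall i.+1)) => bi; last first.
    rewrite addn0 => h; apply: lt_le_trans (mono _ im); apply: IH => //; exact: ltnW.
  rewrite addn1 => _; case: (posnP (nb i.+1)) => [->|h].
    by have := out _ im; rewrite bi subrr mul0r addr0.
  have := gain _ im bi; have := IH (ltnW im) h.
  rewrite -natr1; lra.
(* After the low bounce the elevation exceeds - (pi / 2 - A); the tall bounce
   that follows lifts it above pi / 2 - A, too steep for another low bounce. *)
have D i : (i < m)%N -> ns i.+1 = 0%N \/ (ns i.+1 = 1%N /\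
   ((- (pi / 2 - A) < E i /\ ~~ tall i) \/ pi / 2 - A < E i)).
  elim: i => [|i IH] im.
    rewrite nsS ns0; have := out _ im.
    by case: (tall 0) => /= h; [left|right; split => //; left].
  rewrite nsS; have := out _ im; have := nosm _ (ltnW im); have := inn _ (ltnW im).
  have := gain _ im; have := mono _ im.
  case: (tall i.+1) => /= mon ga inni nos ou.
    rewrite addn0; case: (IH (ltnW im)) => [->|[-> [[h1 _]|h1]]]; first by left.
      by right; split => //; right; have := ga isT; lra.
    by right; split => //; right; lra.
  right; case: (IH (ltnW im)) => [->|[_ [[_ h]|h]]].
  - by split => //; left.
  - by move: nos; rewrite (negbTE h).
  - lra.
case: m out inn mono gain nosm C D => [|m] out inn mono gain nosm C D.
  by rewrite sub0r mulN1r; lra.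
have ns1 : (ns m.+2 <= 1)%N.
  rewrite (nsS m.+1); have := inn m (ltnSn _); have := nosm m (ltnSn _).
  case: (tall m.+1) => /= h1 h2; case: (D m (ltnSn _)) => [->//|[-> h]] //.
  by case: h => [[_ h]|h]; [move: h1; rewrite (negbTE h)|lra].
suff nbound : ((nb m.+2)%:R - 1) * (pi - 2 * A) < pi.
  apply: le_lt_trans nbound; rewrite ler_wpM2r//; first lra.
  rewrite lerB// ler_nat; have := nbs m.+2; lia.
have := inn m (ltnSn _); have := C m (ltnSn _).
rewrite (nbS m.+1); case: (posnP (nb m.+1)) => [->|h].
  by move=> _ _; case: (tall m.+1) => /=; rewrite ?subrr ?sub0r ?mul0r ?mulN1r; lra.
move=> /(_ isT); case: (tall m.+1) => /=; last by rewrite addn0; lra.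
by rewrite addn1 -natr1; lra.
Qed.

End Count.

(** * Induction on a real interval *)

Section RealInduction.
Context {R : realType}.
Implicit Types (P : R -> Prop) (a b x : R).

Lemma near_rightP P x : (\forall y \near x^'+, P y) <->
  exists2 e, x < e & forall y, x < y < e -> P y.
Proof.
split=> [/nbhs_ballP[e /= e0 h]|[e xe h]].
  exists (x + e) => [|y /andP[xy ye]]; first by rewrite ltrDl.
  by apply: h => //; rewrite /ball /= ltr_norml; apply/andP; split; lra.
apply/nbhs_ballP; exists (e - x) => /= [|y]; first by rewrite subr_gt0.
rewrite /ball /= ltr_norml => /andP[? ?] ?; apply: h; lra.
Qed.

Lemma near_leftP P x : (\forall y \near x^'-, P y) <->
  exists2 e, e < x & forall y, e < y < x -> P y.
Proof.
split=> [/nbhs_ballP[e /= e0 h]|[e xe h]].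
  exists (x - e) => [|y /andP[xy ye]]; first by rewrite ltrBlDr ltrDl.
  by apply: h => //; rewrite /ball /= ltr_norml; apply/andP; split; lra.
apply/nbhs_ballP; exists (x - e) => /= [|y]; first by rewrite subr_gt0.
rewrite /ball /= ltr_norml => /andP[? ?] ?; apply: h; lra.
Qed.

(** The supremum of the points up to which [P] holds satisfies [P] by the left
    closure condition, and is the right end since otherwise [P] extends. *)
Lemma real_induction P a b : P a ->
  (forall x, a <= x < b -> (forall y, a <= y <= x -> P y) ->
     \forall y \near x^'+, P y) ->
  (forall x, a < x <= b -> (forall y, a <= y < x -> P y) -> P x) ->
  forall x, a <= x <= b -> P x.
Proof.
move=> Pa right left x /andP[ax xb].
pose S := [set z | a <= z <= b /\ forall y, a <= y <= z -> P y].
have Sa : S a.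
  split=> [|y /andP[ay ya]]; first by rewrite lexx (le_trans ax).
  by have -> : y = a by apply/eqP; rewrite eq_le ya ay.
have supS : has_sup S by split; [exists a | exists b => z [/andP[]]].
pose c := sup S.
have ac : a <= c by apply: sup_upper_bound.
have cb : c <= b by apply: ge_sup => [|z [/andP[]]//]; exists a.
have Pc_lt y : a <= y < c -> P y.
  move=> /andP[ay yc].
  have [z [_ hz] yz] := sup_adherent (etrans (subr_gt0 y c) yc) supS.
  by apply: hz; rewrite ay ltW//; move: yz; rewrite -/c subKr.
have Pc y : a <= y <= c -> P y.
  move=> /andP[ay]; rewrite le_eqVlt => /predU1P[->|yc]; last by apply: Pc_lt; rewrite ay.
  move: ac; rewrite le_eqVlt => /predU1P[<-//|ac'].
  by apply: left => //; rewrite ac'.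
case: (ltP c b) => [cb'|bc]; last by apply: Pc; rewrite ax (le_trans xb).
have /near_rightP[e ce he] : \forall y \near c^'+, P y.
  by apply: right => //; rewrite ac.
pose d := (c + Num.min e b) / 2.
have ce' : c < Num.min e b by rewrite lt_min ce.
have cd : c < d by rewrite /d; lra.
have dm : d < Num.min e b by rewrite /d; lra.
have : S d.
  split; first by rewrite (le_trans ac (ltW cd)) ltW// (lt_le_trans dm)// ge_min lexx orbT.
  move=> y /andP[ay yd]; case: (leP y c) => yc; first by apply: Pc; rewrite ay.
  by apply: he; rewrite yc (le_lt_trans yd)// (lt_le_trans dm)// ge_min lexx.
by move=> /(sup_upper_bound supS); rewrite leNgt cd.
Qed.

End RealInduction.

(** With a positive derivative [f] would be negative just before [t]. *)
Lemma derive_le0_left {R : realType} (f : R -> R) (t l : R) :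
  is_derive t 1 f l -> f t = 0 -> (\forall s \near t^'-, 0 <= f s) -> l <= 0.
Proof.
move=> [fd fl] ft0 /near_leftP[e et fge]; rewrite leNgt; apply/negP => l0.
have := fd; rewrite /derivable => /cvg_ex[/= l' hl'].
have ll' : l' = l by rewrite -fl /derive; apply/esym/cvg_lim.
rewrite {}ll' in hl'.
have : \forall h \near 0^', 0 < h^-1 *: (f (h *: 1 + t) - f t) by exact: cvgr_gt hl' _ l0.
move=> /nbhs_ballP[d /= d0 hd].
pose h := Num.min d (t - e) / 2.
have m0 : 0 < Num.min d (t - e) by rewrite lt_min d0 subr_gt0.
have h0 : 0 < h by rewrite /h; lra.
have hm : h < Num.min d (t - e) by rewrite /h; lra.
have hd' : h < d by rewrite (lt_le_trans hm)// ge_min lexx.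
have he : h < t - e by rewrite (lt_le_trans hm)// ge_min lexx orbT.
have := hd (- h); rewrite /ball /= sub0r opprK gtr0_norm// oppr_eq0 gt_eqF//.
move=> /(_ hd' isT); rewrite ft0 subr0 /GRing.scale /= mulr1 invrN mulNr oppr_gt0.
rewrite pmulr_rlt0 ?invr_gt0//; apply/negP; rewrite -leNgt; apply: fge.
by apply/andP; split; lra.
Qed.

(** * Straight flights *)

Lemma reflect_mirror {R : realType} (k a : R) (v : R * R) :
  Defs.reflect k a v = mirror (k * cos a) v.
Proof.
rewrite /Defs.reflect /mirror /normal_rate /Defs.dot /Defs.normal /=.
have -> : v.1 * - (k * cos a) + v.2 * 1 = v.2 - k * cos a * v.1 by ring.
have -> : - (k * cos a) * - (k * cos a) + 1 * 1 = 1 + (k * cos a) ^+ 2 by ring.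
by congr pair; ring.
Qed.

Section Flight.
Context {R : realType} (m1 m2 : R) (y phi : R -> R).
Implicit Types (t s a b : R) (v w : R * R).

Let pos t : R * R := (phi t, scaledY m1 m2 y t).
Let moves := moves_with m1 m2 y phi.
Let incoming := Defs.incoming m1 m2 y phi.
Let outgoing := Defs.outgoing m1 m2 y phi.

Lemma moves_with_inj v w t s : s != t -> moves v t s -> moves w t s -> v = w.
Proof.
move=> st [h1 h2] [h3 h4]; have st0 : s - t != 0 by rewrite subr_eq0.
case: v w h1 h2 h3 h4 => [v1 v2] [w1 w2] /= -> -> /addrI/(mulfI st0)-> /addrI/(mulfI st0)->.
by [].
Qed.

Lemma moves_with_shift v t s r : moves v t s -> moves v t r -> moves v s r.
Proof. by move=> [h1 h2] [h3 h4]; split; rewrite ?h1 ?h2 ?h3 ?h4; ring. Qed.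

Lemma moves_with_unshift v t s r : moves v t s -> moves v s r -> moves v t r.
Proof. by move=> [h1 h2] [h3 h4]; split; rewrite ?h3 ?h4 ?h1 ?h2; ring. Qed.

Lemma moves_with_sym v t s : moves v t s -> moves v s t.
Proof. by move=> [h1 h2]; split; rewrite ?h1 ?h2; ring. Qed.

(** One-sided velocities are determined by the motion, so a collision is a
    genuine discontinuity of the velocity. *)
Lemma incoming_moves v w t a : a < t -> (forall s, a < s < t -> moves w t s) ->
  incoming t v -> v = w.
Proof.
move=> at_ h /near_leftP[e et he].
pose s := (t + Num.max a e) / 2.
have m : Num.max a e < t by rewrite gt_max at_.
have st : s < t by rewrite /s; lra.
have ms : Num.max a e < s by rewrite /s; lra.
apply: (@moves_with_inj _ _ t s); first by rewrite lt_eqF.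
  by apply: he; rewrite st (le_lt_trans _ ms)// le_max lexx orbT.
by apply: h; rewrite st (le_lt_trans _ ms)// le_max lexx.
Qed.

Lemma outgoing_moves v w t b : t < b -> (forall s, t < s < b -> moves w t s) ->
  outgoing t v -> v = w.
Proof.
move=> tb h /near_rightP[e et he].
pose s := (t + Num.min b e) / 2.
have m : t < Num.min b e by rewrite lt_min tb.
have st : t < s by rewrite /s; lra.
have ms : s < Num.min b e by rewrite /s; lra.
apply: (@moves_with_inj _ _ t s); first by rewrite gt_eqF.
  by apply: he; rewrite st (lt_le_trans ms)// ge_min lexx orbT.
by apply: h; rewrite st (lt_le_trans ms)// ge_min lexx.
Qed.

Lemma incoming_inj t v w : incoming t v -> incoming t w -> v = w.
Proof. by move=> h /near_leftP[e et he]; exact: (incoming_moves _ _ _ _ et he h). Qed.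

Lemma outgoing_inj t v w : outgoing t v -> outgoing t w -> v = w.
Proof. by move=> h /near_rightP[e et he]; exact: (outgoing_moves _ _ _ _ et he h). Qed.

Lemma straight_no_jump t v a b s : (forall r, a < r < b -> moves v t r) ->
  a < s < b -> incoming s v /\ outgoing s v.
Proof.
move=> h sab; have /andP[as_ sb] := sab; split.
  apply/near_leftP; exists a => // r /andP[ar rs].
  apply: moves_with_shift (h _ sab) _; apply: h.
  by rewrite ar (lt_trans rs).
apply/near_rightP; exists b => // r /andP[sr rb].
apply: moves_with_shift (h _ sab) _; apply: h.
by rewrite rb (lt_trans as_).
Qed.

Context (T : set R) (motion : dumbbell_motion m1 m2 y phi T).
Context (no_double : forall t, T t ->
  ~ (height1 m1 m2 y phi t = 0 /\ height2 m1 m2 y phi t = 0)).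
Context (T_itv : is_interval T).

Let coll := collisions m1 m2 y phi T.

Lemma velocities t : T t -> exists v w, incoming t v /\ outgoing t w.
Proof.
move=> Tt; have [h1 h2] := above_floor motion Tt; have := no_double _ Tt.
move: h1 h2; rewrite !le_eqVlt => /predU1P[e1|l1] /predU1P[e2|l2] n.
- by case: n.
- by have [v [? ?]] := bounce1 motion Tt (esym e1) l2; exists v; eexists; split; eauto.
- by have [v [? ?]] := bounce2 motion Tt l1 (esym e2); exists v; eexists; split; eauto.
- by have [v [? ?]] := free_flight motion Tt l1 l2; exists v; eexists; split; eauto.
Qed.

Lemma no_collision_straight t : T t -> ~ coll t -> exists v, incoming t v /\ outgoing t v.
Proof.
move=> Tt nc; have [h1 h2] := above_floor motion Tt.
case: (pselect (height1 m1 m2 y phi t = 0 \/ height2 m1 m2 y phi t = 0)) => [h|/not_orP[n1 n2]].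
  have [v [w [hv hw]]] := velocities _ Tt; exists v; split => //.
  suff -> : v = w by [].
  by apply: contrapT => vw; apply: nc; split => //; exists v, w.
by apply: (free_flight motion Tt); rewrite lt_neqAle eq_sym ?h1 ?h2 andbT; apply/eqP.
Qed.

Lemma straight_no_collision t v a b s : (forall r, a < r < b -> moves v t r) ->
  a < s < b -> ~ coll s.
Proof.
move=> h sab [_ _ [w [w' [hw hw' ww']]]]; have [hi ho] := straight_no_jump _ _ _ _ _ h sab.
by apply: ww'; rewrite (incoming_inj _ _ _ hw hi) (outgoing_inj _ _ _ hw' ho).
Qed.

Lemma between_T a b t : T a -> T b -> a <= t <= b -> T t.
Proof. by move=> Ta Tb abt; exact: T_itv abt. Qed.

(** Away from collisions the velocities on the two sides agree, so straight
    motion extends to the right; it extends to a left limit because the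
    incoming velocity there agrees with [v] at two earlier points. *)
Lemma flight a b v : T a -> T b -> a < b -> outgoing a v ->
  (forall s, a < s < b -> ~ coll s) ->
  (forall s, a <= s <= b -> moves v a s) /\ incoming b v.
Proof.
move=> Ta Tb ab va nc.
have aa : moves v a a by split; rewrite subrr mul0r addr0.
have fl : forall s, a <= s <= b -> moves v a s.
  apply: real_induction => // x.
    move=> /andP[ax xb] h; move: ax; rewrite le_eqVlt => /predU1P[<-//|ax].
    have Tx : T x by apply: (between_T a b) => //; rewrite !ltW.
    have [|w [hi ho]] := no_collision_straight _ Tx; first by apply: nc; rewrite ax.
    have wv : w = v.
      apply: incoming_moves ax _ hi => s /andP[as_ sx].
      by apply: (moves_with_shift v a); apply: h; lra.
    rewrite wv in ho; apply: filterS ho => s; apply: moves_with_unshift.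
    by apply: h; lra.
  move=> /andP[ax xb] h.
  have Tx : T x by apply: (between_T a b) => //; rewrite xb ltW.
  have [w [_ [hi _]]] := velocities _ Tx.
  have /near_leftP[e ex he] := hi.
  pose s := (x + Num.max a e) / 2; pose r := (x + s) / 2.
  have m : Num.max a e < x by rewrite gt_max ax.
  have sx : s < x by rewrite /s; lra.
  have ms : Num.max a e < s by rewrite /s; lra.
  have [as_ es] : a < s /\ e < s by move: ms; rewrite gt_max => /andP[].
  have [sr rx] : s < r /\ r < x by rewrite /r; lra.
  have ws : moves w x s by apply: he; rewrite es.
  have wr : moves w x r by apply: he; rewrite rx (lt_trans es).
  have vs : moves v a s by apply: h; lra.
  have vr : moves v a r by apply: h; lra.
  have wv : w = v.
    apply: (moves_with_inj _ _ s r); first by rewrite gt_eqF.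
      exact: moves_with_shift wr.
    exact: moves_with_shift vr.
  rewrite wv in ws; apply: moves_with_unshift vs _.
  exact: moves_with_sym.
split => //; apply/near_leftP; exists a => // s /andP[as_ sb].
by apply: (moves_with_shift v a); apply: fl; lra.
Qed.

Lemma no_collision_right t : T t -> \forall s \near t^'+, ~ coll s.
Proof.
move=> Tt; have [_ [w [_ /near_rightP[e te he]]]] := velocities _ Tt.
by apply/near_rightP; exists e => // s; exact: (straight_no_collision _ _ _ _ _ he).
Qed.

Lemma no_collision_left t : T t -> \forall s \near t^'-, ~ coll s.
Proof.
move=> Tt; have [w [_ [/near_leftP[e te he] _]]] := velocities _ Tt.
by apply/near_leftP; exists e => // s; exact: (straight_no_collision _ _ _ _ _ he).
Qed.

(** Every time has one-sided neighbourhoods without collisions. *)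
Lemma finite_collisions a b : T a -> T b -> finite_set (coll `&` `[a, b]).
Proof.
move=> Ta Tb; case: (leP a b) => ab; last first.
  by rewrite set_itv_ge ?setI0// -leNgt.
apply: (@real_induction _ (fun x => finite_set (coll `&` `[a, x])) a b); last by rewrite ab lexx.
- by rewrite set_itv1; apply: finite_setIr; exact: finite_set1.
- move=> x /andP[ax xb] h.
  have Tx : T x by apply: (between_T a b) => //; rewrite ax ltW.
  have /near_rightP[e xe he] := no_collision_right _ Tx.
  apply/near_rightP; exists e => // s /andP[xs se].
  have := h x; rewrite lexx ax => /(_ isT); apply: sub_finite_set => r [cr].
  rewrite /= !in_itv/= => /andP[ar rs]; split => //; rewrite /= ?in_itv/= ar leNgt.
  by apply/negP => xr; apply: (he r) => //; rewrite xr (le_lt_trans rs).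
- move=> x /andP[ax xb] h.
  have Tx : T x by apply: (between_T a b) => //; rewrite xb ltW.
  have /near_leftP[e xe he] := no_collision_left _ Tx.
  pose s := Num.max a e.
  have sx : s < x by rewrite gt_max ax.
  have : finite_set ((coll `&` `[a, s]) `|` [set x]).
    by rewrite finite_setU; split; [apply: h; rewrite sx le_max lexx|exact: finite_set1].
  apply: sub_finite_set => r [cr]; rewrite /= in_itv/= => /andP[ar].
  rewrite le_eqVlt => /predU1P[->|rx]; [by right|left; split => //].
  rewrite /= ?in_itv/= ar leNgt; apply/negP => sr; apply: (he r) => //.
  by rewrite rx andbT (le_lt_trans _ sr)// le_max lexx orbT.
Qed.

(** * Bounces of the dumbbell *)

Context (m1_gt0 : 0 < m1) (m2_gt0 : 0 < m2) (m1_le_m2 : m1 <= m2).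
Context (T_open : open T).

Let K : R := Num.sqrt (beta2 m1 m2 / beta1 m1 m2).

Lemma beta_gt0 : 0 < beta1 m1 m2 /\ 0 < beta2 m1 m2.
Proof. by rewrite /beta1 /beta2 !divr_gt0 ?addr_gt0. Qed.

Lemma steepness_ge1 : 1 <= K.
Proof.
have [b1 b2] := beta_gt0.
rewrite -[X in X <= _]sqrtr1 ler_wsqrtr// ler_pdivlMr// mul1r.
by rewrite /beta1 /beta2 ler_wpM2r// invr_ge0 ltW// addr_gt0.
Qed.

Lemma slope2E : slope2 m1 m2 = K^-1.
Proof.
have [b1 b2] := beta_gt0.
rewrite /slope2 /K -sqrtrV; last by apply: divr_ge0; exact: ltW.
by rewrite [(beta2 m1 m2 / _)^-1]invf_div.
Qed.

Let unit_gt0 : 0 < Num.sqrt (beta1 m1 m2 * beta2 m1 m2).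
Proof. by have [b1 b2] := beta_gt0; rewrite sqrtr_gt0 mulr_gt0. Qed.

(** The scale factor between y and Y turns the coefficients of the sine in the
    two heights into the slopes of the arches. *)
Lemma sqrt_mul_ratio (b c : R) : 0 < b -> 0 < c ->
  Num.sqrt (b * c) * Num.sqrt (c / b) = c.
Proof.
move=> b0 c0; rewrite -sqrtrM ?mulr_ge0 ?ltW//.
have -> : b * c * (c / b) = c ^+ 2 by field; rewrite gt_eqF.
by rewrite sqrtr_sqr gtr0_norm.
Qed.

Lemma height1E t : height1 m1 m2 y phi t =
  Num.sqrt (beta1 m1 m2 * beta2 m1 m2) * ((pos t).2 - slope1 m1 m2 * sin (pos t).1).
Proof.
have [b1 b2] := beta_gt0.
rewrite /height1 /pos /scaledY /slope1 /= mulNr opprK mulrDr mulrCA divff ?gt_eqF// mulr1.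
by rewrite mulrA sqrt_mul_ratio.
Qed.

Lemma height2E t : height2 m1 m2 y phi t =
  Num.sqrt (beta1 m1 m2 * beta2 m1 m2) * ((pos t).2 - slope2 m1 m2 * sin (pos t).1).
Proof.
have [b1 b2] := beta_gt0.
rewrite /height2 /pos /scaledY /slope2 /= mulrBr mulrCA divff ?gt_eqF// mulr1.
by rewrite mulrA [beta1 m1 m2 * beta2 m1 m2]mulrC sqrt_mul_ratio.
Qed.

Definition tall t := height1 m1 m2 y phi t == 0.
Definition bump t : R := if tall t then - K else K^-1.
Definition slope_at t := bump t * cos (phi t).
Definition departure t : R * R := xget (0, 0) [set w | outgoing t w].

Lemma above t k : T t -> k = - K \/ k = K^-1 -> k * sin (pos t).1 <= (pos t).2.
Proof.
move=> Tt hk; have [] := above_floor motion Tt.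
rewrite height1E height2E !pmulr_rge0// !subr_ge0 slope2E.
by case: hk => ->.
Qed.

Lemma bump_cases t : bump t = - K \/ bump t = K^-1.
Proof. by rewrite /bump; case: (tall t); [left|right]. Qed.

(** Touching one curve while strictly above the other puts the particle at
    positive height, as the two coefficients have opposite signs. *)
Lemma bump_contact t : T t -> height1 m1 m2 y phi t = 0 \/ height2 m1 m2 y phi t = 0 ->
  contact (bump t) (pos t).
Proof.
move=> Tt h; have K1 := steepness_ge1; have K0 : 0 < K by lra.
have Kv0 : 0 < K^-1 by rewrite invr_gt0.
have [a1 a2] := above_floor motion Tt; have nd := no_double _ Tt.
rewrite /bump /tall; case: eqP h => [h1 _|h1 [//|h2]].
  have h2 : 0 < height2 m1 m2 y phi t.
    by rewrite lt_neqAle a2 andbT eq_sym; apply/eqP => h2; apply: nd.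
  move: h1 h2; rewrite height1E height2E pmulr_rgt0// subr_gt0 slope2E /slope1 -/K.
  move=> /eqP; rewrite mulf_eq0 gt_eqF//= subr_eq0 => /eqP e; rewrite /contact /= e.
  move=> h; split => //; have : sin (phi t) < 0 by rewrite ltNge; apply/negP => s; nra.
  by move=> s; rewrite mulNr oppr_gt0 pmulr_rlt0.
have {}h1 : 0 < height1 m1 m2 y phi t.
  by rewrite lt_neqAle a1 andbT eq_sym; apply/eqP.
move: h1 h2; rewrite height1E height2E pmulr_rgt0// subr_gt0 slope2E /slope1 -/K.
move=> h /eqP; rewrite mulf_eq0 gt_eqF//= subr_eq0 => /eqP e; rewrite /contact /= e.
rewrite /= e in h; split => //; have : 0 < sin (phi t) by rewrite ltNge; apply/negP => s; nra.
by move=> s; rewrite mulr_gt0.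
Qed.

Lemma bounce t : T t -> height1 m1 m2 y phi t = 0 \/ height2 m1 m2 y phi t = 0 ->
  exists v, incoming t v /\ outgoing t (mirror (slope_at t) v).
Proof.
move=> Tt h; have [a1 a2] := above_floor motion Tt; have nd := no_double _ Tt.
rewrite /slope_at /bump /tall; case: eqP h => [h1 _|h1 [//|h2]].
  have h2 : 0 < height2 m1 m2 y phi t.
    by rewrite lt_neqAle a2 andbT eq_sym; apply/eqP => h2; apply: nd.
  by have [v] := bounce1 motion Tt h1 h2; rewrite reflect_mirror; exists v.
have {}h1 : 0 < height1 m1 m2 y phi t.
  by rewrite lt_neqAle a1 andbT eq_sym; apply/eqP.
by have [v] := bounce2 motion Tt h1 h2; rewrite reflect_mirror slope2E; exists v.
Qed.

(** The clearance above the arch is nonnegative before the contact and vanishes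
    at it, and its derivative is [normal_rate]. *)
Lemma incoming_normal_rate t v : T t -> contact (bump t) (pos t) -> incoming t v ->
  normal_rate (slope_at t) v <= 0.
Proof.
move=> Tt [ct _] hv.
pose f s := (pos t).2 + (s - t) * v.2 - bump t * sin ((pos t).1 + (s - t) * v.1).
apply: (@derive_le0_left _ f t).
- rewrite /f /normal_rate /slope_at.
  have hd : is_derive t 1 (fun s : R => (s - t)) 1.
    by apply: is_derive_eq; rewrite subr0.
  apply: is_derive_eq.
  by rewrite subrr mul0r addr0 /= /GRing.scale /=; ring.
- by rewrite /f subrr !mul0r !addr0 ct subrr.
- have Tn : \forall s \near t^'-, T s.
    have /nbhs_ballP[e /= e0 he] := T_open _ Tt.
    apply/near_leftP; exists (t - e) => [|s /andP[s1 s2]]; first by rewrite ltrBlDr ltrDl.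
    by apply: he; rewrite /ball/= gtr0_norm; lra.
  apply: filterS2 hv Tn => s [h1 h2] Ts.
  by rewrite /f -h1 -h2 subr_ge0; apply: above => //; exact: bump_cases.
Qed.

(** A velocity jump rules out tangential contacts, so the incoming velocity
    points strictly into the arch. *)
Lemma hit t : coll t ->
  [/\ contact (bump t) (pos t), outgoing t (departure t) &
   exists v, [/\ incoming t v, normal_rate (slope_at t) v < 0 & departure t = mirror (slope_at t) v]].
Proof.
move=> [Tt h [v [w [hv hw vw]]]].
have ct := bump_contact _ Tt h; have [v' [hv' ho]] := bounce _ Tt h.
have e := incoming_inj _ _ _ hv hv'; subst v'.
have dE : outgoing t (departure t) by rewrite /departure; case: xgetP => [? -> //|/(_ w)].
split => //; exists v; split => //; last exact: outgoing_inj dE ho.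
rewrite lt_neqAle incoming_normal_rate// andbT; apply/eqP => l0.
apply: vw; rewrite (outgoing_inj _ _ _ hw ho) /mirror l0.
by rewrite mulr0 !mul0r addr0 subr0; case: (v).
Qed.

Definition consecutive t t' := [/\ coll t, coll t', t < t' & forall s, t < s < t' -> ~ coll s].

Lemma consecutive_flight t t' : consecutive t t' ->
  [/\ forall s, t <= s <= t' -> moves (departure t) t s,
      0 < normal_rate (slope_at t) (departure t), normal_rate (slope_at t') (departure t) < 0 &
      departure t' = mirror (slope_at t') (departure t)].
Proof.
move=> [ct ct' tt' nc]; have [_ od [v [_ lv dE]]] := hit _ ct.
have [_ _ [v' [iv' lv' dE']]] := hit _ ct'.
have [Tt _ _] := ct; have [Tt' _ _] := ct'.
have [fl ib] := flight _ _ _ Tt Tt' tt' od nc.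
have e := incoming_inj _ _ _ ib iv'; split => //; last 2 first.
- by rewrite e.
- by rewrite e.
- by rewrite dE normal_rate_mirror oppr_gt0.
Qed.

(** A vertical flight would have to go up when it starts and down when it ends. *)
Lemma consecutive_not_vertical t t' : consecutive t t' -> (departure t).1 != 0.
Proof.
move=> /consecutive_flight[_ h1 h2 _]; apply/eqP => h; move: h1 h2.
by rewrite /normal_rate h !mulr0 !subr0 => h1 h2; have := lt_trans h1 h2; rewrite ltxx.
Qed.

Lemma slope_le t : `|slope_at t| <= if tall t then K else K^-1.
Proof.
have K1 := steepness_ge1; have K0 : 0 < K by lra.
have c1 : `|cos (phi t)| <= 1 by rewrite ler_norml cos_itv.
have nb : `|bump t| = if tall t then K else K^-1.
  by rewrite /bump; case: (tall t); rewrite ?normrN gtr0_norm ?invr_gt0.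
by rewrite /slope_at normrM nb ler_piMr//; case: (tall t); rewrite ?invr_ge0 ltW.
Qed.

Lemma atanV (x : R) : 0 < x -> atan x^-1 = pi / 2 - atan x.
Proof.
move=> x0; have pi0 := pi_gt0 R.
have h1 := atan_ltpi2 x; have h2 : 0 < atan x by rewrite -(@atan0 R); exact: lt_atan.
rewrite -[RHS]tanK; last by rewrite in_itv/=; lra.
congr atan; rewrite /tan sinB cosB sin_pihalf cos_pihalf !mul1r !mul0r subr0 add0r.
by rewrite -invf_div -/(tan _) atanK.
Qed.

Lemma atan_slope_bound t :
  atan (if tall t then K else K^-1) = if tall t then atan K else pi / 2 - atan K.
Proof.
have K1 := steepness_ge1; have K0 : 0 < K by lra.
by case: (tall t); rewrite ?atanV.
Qed.

Lemma consecutive_elevation_gt t t' : consecutive t t' ->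
  - (if tall t then atan K else pi / 2 - atan K) < elevation (departure t).
Proof.
move=> n; have [_ h _ _] := consecutive_flight _ _ n; rewrite -atan_slope_bound.
exact: elevation_gt (consecutive_not_vertical _ _ n) (slope_le t) h.
Qed.

Lemma consecutive_elevation_lt t t' : consecutive t t' ->
  elevation (departure t) < if tall t' then atan K else pi / 2 - atan K.
Proof.
move=> n; have [_ _ h _] := consecutive_flight _ _ n; rewrite -atan_slope_bound.
exact: elevation_lt (consecutive_not_vertical _ _ n) (slope_le t') h.
Qed.

Lemma consecutive_elevation_le t t' t'' : consecutive t t' -> consecutive t' t'' ->
  elevation (departure t) <= elevation (departure t').
Proof.
move=> n n'; have [_ _ h e] := consecutive_flight _ _ n.
have := consecutive_not_vertical _ _ n'; rewrite e => nv.
by apply: elevation_mirror (consecutive_not_vertical _ _ n) nv (ltW h).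
Qed.

Lemma bump_vs_tall t : `|bump t| <= `|- K| /\ (bump t = - K \/ bump t * - K < 0).
Proof.
have K1 := steepness_ge1; have K0 : 0 < K by lra.
rewrite /bump; case: (tall t); first by split=> //; left.
split; last by right; rewrite mulrN mulVf ?gt_eqF// oppr_lt0.
rewrite normrN !gtr0_norm ?invr_gt0//; apply: (@le_trans _ _ 1) => //.
by rewrite invf_le1.
Qed.

(** The middle one of three consecutive collisions, if tall, reverses the
    horizontal velocity. *)
Lemma consecutive_elevation_gain t t' t'' : consecutive t t' -> consecutive t' t'' -> tall t' ->
  elevation (departure t) + (pi - 2 * atan K) <= elevation (departure t').
Proof.
move=> n n' bt'; have [fl _ h e] := consecutive_flight _ _ n; have [fl' _ _ _] := consecutive_flight _ _ n'.
have [ct ct' tt' _] := n; have [_ ct'' tt'' _] := n'.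
have [kt _ _] := hit _ ct; have [kt' _ _] := hit _ ct'; have [kt'' _ _] := hit _ ct''.
have bE : bump t' = - K by rewrite /bump bt'.
have sE : slope_at t' = - K * cos (pos t').1 by rewrite /slope_at bE.
have rev : (departure t).1 * (mirror (slope_at t') (departure t)).1 < 0.
  have [k1 k2] := bump_vs_tall t; have [k3 k4] := bump_vs_tall t''.
  rewrite bE in kt'; rewrite sE in h *.
  apply: (tall_bump_reverses _ _ _ _ _ _ _ (t' - t) (t'' - t') kt' kt kt'') => //.
  - by rewrite subr_gt0.
  - have [|e1 e2] := fl t'; first by rewrite lexx ltW.
    by rewrite /pos /= e1 e2 !addrK.
  - by rewrite subr_gt0.
  - rewrite -sE -e; have [|e1 e2] := fl' t''; first by rewrite lexx ltW.
    by rewrite /pos /= e1 e2.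
rewrite e elevation_reversal// lerD2l lerD2l lerN2 ler_pM2l//.
by apply: le_atan; have := slope_le t'; rewrite bt'.
Qed.

Lemma consecutive_tall t t' : consecutive t t' -> tall t || tall t'.
Proof.
move=> n; apply: contrapT => /negP; rewrite negb_or => /andP[/negbTE b /negbTE b'].
have [fl l1 l2 _] := consecutive_flight _ _ n; have [ct ct' tt' _] := n.
have [kt _ _] := hit _ ct; have [kt' _ _] := hit _ ct'.
rewrite /slope_at /bump b in l1 kt; rewrite /slope_at /bump b' in l2 kt'.
have [||//|//|r /andP[r0 rt]] := no_consecutive_low _ _ _ (departure t) (t' - t) steepness_ge1 kt kt'.
- by rewrite subr_gt0.
- have [|e1 e2] := fl t'; first by rewrite lexx ltW.
  by rewrite /pos /= e1 e2.
have trt : t <= t + r <= t' by lra.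
have [e1 e2] := fl _ trt; have [Tt _ _] := ct; have [Tt' _ _] := ct'.
have := above (t + r) (- K) (between_T _ _ _ Tt Tt' trt) (or_introl erefl).
by rewrite /pos /= e1 e2 [t + r - t]addrAC subrr add0r leNgt => /negP.
Qed.

Lemma wedge_angle_gt0 : 0 < wedge_angle m1 m2.
Proof. by rewrite /wedge_angle; have := atan_ltpi2 K; rewrite -/K; lra. Qed.

Lemma Ngamma_ge0 : 0 <= Ngamma m1 m2.
Proof.
rewrite /Ngamma addr_ge0// ceil_ge0 (lt_le_trans (ltrN10 _))//.
by rewrite divr_ge0 ?pi_ge0// ltW// wedge_angle_gt0.
Qed.

Lemma chain_bound (tau : nat -> R) m : (forall i, (i < m)%N -> consecutive (tau i) (tau i.+1)) ->
  m.+1%:Z <= Ngamma m1 m2.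
Proof.
move=> nx; have K1 := steepness_ge1.
have A1 : pi / 4 <= atan K by rewrite -atan1; exact: le_atan.
have A2 : atan K < pi / 2 by exact: atan_ltpi2.
have : (m%:R - 1) * (pi - 2 * atan K) < pi.
  apply: (@bounce_count _ (atan K) m (fun i => tall (tau i)) (fun i => elevation (departure (tau i)))) => //.
  - by move=> i /nx; exact: consecutive_elevation_gt.
  - by move=> i /nx; exact: consecutive_elevation_lt.
  - by move=> i im; exact: consecutive_elevation_le (nx _ (ltnW im)) (nx _ im).
  - by move=> i im; exact: consecutive_elevation_gain (nx _ (ltnW im)) (nx _ im).
  - by move=> i /nx; exact: consecutive_tall.
rewrite -ltr_pdivlMr; last exact: wedge_angle_gt0.
move=> h; rewrite /Ngamma /wedge_angle -/K -addn1 PoszD lerD2r.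
rewrite -ltzD1 -ltrBlDr -(ltr_int R) rmorphB /=.
by apply: lt_le_trans h _; exact: ceil_ge.
Qed.

(** Sorted in time, the finitely many collisions between [a] and [b] form a
    chain of consecutive ones. *)
Lemma collisions_between_bound a b : T a -> T b ->
  (#|` fset_set (coll `&` `[a, b])|%fset)%:Z <= Ngamma m1 m2.
Proof.
move=> Ta Tb; have fin := finite_collisions _ _ Ta Tb.
set C := fset_set _; pose s := sort <=%R C.
have sz : size s = #|` C|%fset by rewrite size_sort.
have mem_s x : x \in s -> coll x /\ a <= x <= b.
  rewrite mem_sort in_fset_set// inE => -[h]; rewrite /= in_itv/=; done.
have s_mem x : coll x -> a <= x <= b -> x \in s.
  by move=> cx xab; rewrite mem_sort in_fset_set// inE; split.
have srt : sorted <%R s by rewrite lt_sorted_uniq_le sort_uniq fset_uniq sort_le_sorted.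
rewrite -sz; case e : (size s) => [|m].
  by rewrite Ngamma_ge0.
apply: (chain_bound (nth 0 s)) => i im.
have lt_nth j k : (j < k)%N -> (k <= m)%N -> nth 0 s j < nth 0 s k.
  by move=> jk km; apply: sorted_ltn_nth => //; rewrite ?inE ?e//; [exact: lt_trans|lia].
have ni j : (j <= m)%N -> coll (nth 0 s j) /\ a <= nth 0 s j <= b.
  by move=> jm; apply: mem_s; rewrite mem_nth// e.
have [ci /andP[i1 i2]] := ni _ (ltnW im); have [ci' /andP[i1' i2']] := ni _ im.
split => //; first exact: lt_nth.
move=> x /andP[ix xi] cx.
have : x \in s by apply: s_mem => //; rewrite (le_trans i1 (ltW ix)) (le_trans (ltW xi)).
move=> /(nthP 0)[j]; rewrite e ltnS => jm xE; rewrite -xE in ix xi.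
case: (leqP j i) => ji.
  move: ji; rewrite leq_eqVlt => /predU1P[ji|ji]; first by rewrite ji ltxx in ix.
  by have := lt_nth _ _ ji (ltnW im); rewrite ltNge (ltW ix).
move: ji; rewrite leq_eqVlt => /predU1P[ji|ji]; first by rewrite -ji ltxx in xi.
by have := lt_nth _ _ ji jm; rewrite ltNge (ltW xi).
Qed.

Lemma bounded_seq (s : seq R) : s != [::] -> (forall x, x \in s -> T x) ->
  exists a b, [/\ T a, T b & forall x, x \in s -> a <= x <= b].
Proof.
elim: s => // x s IH _ sT.
have Tx : T x by apply: sT; rewrite mem_head.
case: (eqVneq s [::]) => [->|s0].
  by exists x, x; split => // z; rewrite inE => /eqP ->; rewrite lexx.
have [|a [b [Ta Tb h]]] := IH s0; first by move=> z zs; apply: sT; rewrite inE zs orbT.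
exists (Num.min x a), (Num.max x b); split.
- by rewrite /Num.min; case: ifP.
- by rewrite /Num.max; case: ifP.
- move=> z; rewrite inE ge_min le_max => /predU1P[->|/h/andP[-> ->]].
    by rewrite lexx.
  by rewrite !orbT.
Qed.

Lemma collisions_fset_bound (B : {fset R}) : [set` B] `<=` coll ->
  (#|` B|%fset)%:Z <= Ngamma m1 m2.
Proof.
move=> BC; case: (eqVneq (B : seq R) [::]) => [B0|B0].
  by rewrite B0 Ngamma_ge0.
have [|a [b [Ta Tb h]]] := bounded_seq _ B0; first by move=> x /BC[].
apply: le_trans (collisions_between_bound _ _ Ta Tb); rewrite lez_nat.
apply: fsubset_leq_card; apply/fsubsetP => x xB.
rewrite in_fset_set; last exact: finite_collisions.
by rewrite inE; split; [exact: BC|rewrite /= in_itv/=; exact: h].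
Qed.

End Flight.

(** * The collision bound *)

Theorem theorem4p3 (R : realType) (m1 m2 : R) (T : set R) (y phi : R -> R)
    (m1_gt0 : 0 < m1) (m2_gt0 : 0 < m2) (m1_le_m2 : m1 <= m2)
    (T_open : open T) (T_itv : is_interval T)
    (motion : dumbbell_motion m1 m2 y phi T)
    (no_simultaneous_hit : forall t, T t ->
      ~ (height1 m1 m2 y phi t = 0 /\ height2 m1 m2 y phi t = 0)) :
  finite_set (collisions m1 m2 y phi T) /\
  ((#|` fset_set (collisions m1 m2 y phi T)|%fset)%:Z <= Ngamma m1 m2)%R.
Proof.
(* Bounding all finite sets of collisions bounds the whole set, which is
   therefore finite. *)
have bound := collisions_fset_bound _ _ _ _ _ motion no_simultaneous_hit T_itv
  m1_gt0 m2_gt0 m1_le_m2 T_open.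
have fin : finite_set (collisions m1 m2 y phi T).
  apply: contrapT => /(infinite_set_fset (absz (Ngamma m1 m2)).+1)[B /bound] le.
  rewrite -lez_nat => /le_trans/(_ le); lia.
by split=> //; apply: bound => t; rewrite /= in_fset_set// inE.
Qed.
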